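(* Let $\phi=\tilde p/p$ be a rational inner function in three variables of polydegree $(m_1,m_2,1)$ that contains a vertical line singularity $\{(\xi_1,\xi_2)\}\times\mathbb{T}\subset\mathcal Z_p\cap\mathbb{T}^3$. Suppose that the zero set of $\sigma$ on $\mathbb{T}^2$ is of pure real dimension one, so that $\mathcal Z_{\rho_\phi}\cap\mathbb{T}^2=\bigcup_{i=1}^N\gamma_i$ for some $N\in\mathbb{N}$, where each $\gamma_i$ is a real smooth curve. Let $1\le\mathfrak p<\infty$. If $$\int_{B_\varepsilon(\xi_1,\xi_2)}\sigma(z_1,z_2)^{1-\mathfrak p}\,dm(z_1,z_2)<\infty$$ for some small $\varepsilon>0$, then $$\int_{B_\delta(\xi_1,\xi_2)}\rho_\phi(z_1,z_2)^{1-\mathfrak p}\,dm(z_1,z_2)<\infty$$ for some $0<\delta\le\varepsilon$. Specifically, this means that the local $L^{\mathfrak p}_{loc}(\mathbb{T}^3)$-integrability of $\frac{\partial\phi}{\partial z_3}$ at $(\xi_1,\xi_2,\xi_3)$ cannot make the global $L^{\mathfrak p}(\mathbb{T}^3)$-integrability of $\frac{\partial\phi}{\partial z_3}$ worse.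
   Context: $\mathbb{D}$ is the open unit disk in $\mathbb{C}$ and $\mathbb{T}$ the unit circle. A polynomial $p\in\mathbb{C}[z_1,z_2,z_3]$ is stable if it has no zeros in $\mathbb{D}^3$; $\mathcal Z_p$ is its zero set. If $p$ has polydegree $(m_1,m_2,m_3)$ ($m_j$ is the degree in $z_j$), its reflection is $\tilde p(z)=z_1^{m_1}z_2^{m_2}z_3^{m_3}\overline{p(1/\bar z_1,1/\bar z_2,1/\bar z_3)}$. A rational inner function (RIF) here is $\phi=\tilde p/p$ with $p$ stable and $p,\tilde p$ without common factors; the polydegree of $\phi$ is that of $p$. If $\phi$ has polydegree $(m_1,m_2,1)$, write $p(z)=p_1(z_1,z_2)+p_2(z_1,z_2)z_3$ and $\tilde p(z)=\tilde p_1(z_1,z_2)z_3+\tilde p_2(z_1,z_2)$, where $\tilde p_j(z_1,z_2)=z_1^{m_1}z_2^{m_2}\overline{p_j(1/\bar z_1,1/\bar z_2)}$. Set $\sigma=|\tilde p_1|^2-|\tilde p_2|^2$ on $\mathbb{T}^2$, and $\rho_\phi=\sigma/|\tilde p_1|^2$ at the points of $\mathbb{T}^2$ where $\tilde p_1\ne0$. The set $\mathcal Z_{\rho_\phi}\cap\mathbb{T}^2$ consists of the points of $\mathbb{T}^2$ where $\rho_\phi$ is defined and equals zero. A vertical line singularity of $\phi$ is a set $\{\xi\}\times\mathbb{T}\subset\mathcal Z_p\cap\mathbb{T}^3$ with $\xi\in\mathbb{T}^2$; the point $(\xi_1,\xi_2,\xi_3)$, $\xi_3\in\mathbb{T}$,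 is a point of the given vertical line. $B_\varepsilon(w)$ is the ball of radius $\varepsilon$ about $w$ in $\mathbb{T}^2$ and $dm$ is Lebesgue measure on $\mathbb{T}^2$. Local $L^{\mathfrak p}_{loc}(\mathbb{T}^3)$-integrability at a point refers to $L^{\mathfrak p}$-integrability on small neighbourhoods of that point; global integrability means membership in $L^{\mathfrak p}(\mathbb{T}^3)$. *)

(* Defs.v *)
From HB Require Import structures.
From mathcomp Require Import all_boot all_order all_algebra.
From mathcomp Require Import complex.
(* The notations of [mpoly] clash with those of the analysis library. *)
From mathcomp Require Import -(notations) mpoly.
From mathcomp Require Import all_classical all_reals all_analysis.

Set Implicit Arguments.
Unset Strict Implicit.
Unset Printing Implicit Defensive.

Import Order.TTheory GRing.Theory Num.Theory.
Import numFieldNormedType.Exports.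

Local Open Scope classical_set_scope.
Local Open Scope ring_scope.

Notation mpolynomial n C := (mpoly.mpoly n C).
Notation multideg n := (mpoly.multinom n).

Definition mdeg2 (m1 m2 : nat) : multideg 2 := mpoly.Multinom [tuple m1; m2].
Definition mdeg3 (m1 m2 m3 : nat) : multideg 3 :=
  mpoly.Multinom [tuple m1; m2; m3].

Section Polynomials.
Variable R : rcfType.
Local Notation C := R[i].

Definition deg_in n (p : mpolynomial n C) (i : 'I_n) : nat :=
  \max_(k <- mpoly.msupp p) mpoly.fun_of_multinom k i.

Definition has_polydegree n (p : mpolynomial n C) (m : multideg n) : Prop :=
  forall i : 'I_n, deg_in p i = mpoly.fun_of_multinom m i.

(* The polynomial z^m * conj (p (1 / conj z)), written on coefficients. The
   exponent m - k is a truncated subtraction, so this is the reflection only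
   when every degree of p is at most that of m; see [reflectionE]. *)
Definition reflection n (m : multideg n) (p : mpolynomial n C) :
    mpolynomial n C :=
  \sum_(k <- mpoly.msupp p)
    (conjc (mpoly.mcoeff k p)) *: mpoly.mpolyX C (mpoly.mnm_sub m k).

Lemma reflectionE n (m : multideg n) (p : mpolynomial n C) (z : 'I_n -> C) :
  (forall i, (deg_in p i <= mpoly.fun_of_multinom m i)%N) ->
  (forall i, z i != 0) ->
  mpoly.meval z (reflection m p) =
  (\prod_(i < n) z i ^+ mpoly.fun_of_multinom m i) *
  conjc (mpoly.meval (fun i => (conjc (z i))^-1) p).
Proof.
move=> le_pm z0; rewrite /reflection (raddf_sum (mpoly.meval z)).
rewrite (mpoly.mevalE _ p) rmorph_sum mulr_sumr /=.
rewrite big_seq [RHS]big_seq; apply: eq_bigr => k kp.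
rewrite mpoly.mevalZ mpoly.mevalX rmorphM rmorph_prod /= mulrCA; congr (_ * _).
rewrite -big_split /=; apply: eq_bigr => i _.
have ki : (mpoly.fun_of_multinom k i <= mpoly.fun_of_multinom m i)%N.
  apply: leq_trans (le_pm i).
  by rewrite /deg_in (big_rem k) //= leq_maxl.
rewrite mpoly.mnmBE rmorphXn fmorphV /= conjcK expfB_cond; last first.
  by rewrite (negbTE (z0 i)).
by rewrite exprVn.
Qed.

Definition no_common_factor n (p q : mpolynomial n C) : Prop :=
  forall d : mpolynomial n C,
    (exists r, p = d * r) -> (exists r, q = d * r) -> d \is a GRing.unit.

Definition eval2 (p : mpolynomial 2 C) (z : C * C) : C :=
  mpoly.meval (tnth [tuple z.1; z.2]) p.

Definition eval3 (p : mpolynomial 3 C) (z : C * C * C) : C :=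
  mpoly.meval (tnth [tuple z.1.1; z.1.2; z.2]) p.

Definition stable (p : mpolynomial 3 C) : Prop :=
  forall z : C * C * C,
    `|z.1.1| < 1 -> `|z.1.2| < 1 -> `|z.2| < 1 -> eval3 p z != 0.

Definition rif_denominator (m : multideg 3) (p : mpolynomial 3 C) : Prop :=
  [/\ stable p, has_polydegree p m & no_common_factor p (reflection m p)].

End Polynomials.

Section Torus.
Variable R : realType.
Local Notation C := R[i].

(* The modulus as an element of [R] (the norm of [R[i]] takes values in
   [R[i]]). *)
Definition modulus (z : C) : R := ComplexField.Normc.normc z.

Definition circle : set C := [set z | `|z| = 1].
Definition torus2 : set (C * C) := [set z | circle z.1 /\ circle z.2].
Definition torus3 : set (C * C * C) := [set z | torus2 z.1 /\ circle z.2].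

Definition ball2 (w : C * C) (e : R) : set (C * C) :=
  [set z | torus2 z /\ modulus (z.1 - w.1) ^+ 2 + modulus (z.2 - w.2) ^+ 2 < e ^+ 2].

Definition ball3 (w : C * C * C) (e : R) : set (C * C * C) :=
  [set z | torus3 z /\
    modulus (z.1.1 - w.1.1) ^+ 2 + modulus (z.1.2 - w.1.2) ^+ 2
    + modulus (z.2 - w.2) ^+ 2 < e ^+ 2].

Definition cis (t : R) : C := Complex (cos t) (sin t).
Definition cis2 (t : R * R) : C * C := (cis t.1, cis t.2).
Definition cis3 (t : R * R * R) : C * C * C := (cis2 t.1, cis t.2).

Definition angles : set R := `[0, 2 * pi[.

Definition leb2 := (@lebesgue_measure R \x @lebesgue_measure R)%E.
Definition leb3 := (leb2 \x @lebesgue_measure R)%E.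

Definition integral_torus2 (A : set (C * C)) (f : C * C -> \bar R) : \bar R :=
  (\int[leb2]_(t in (angles `*` angles) `&` cis2 @^-1` A) f (cis2 t))%E.

Definition Lp_on_torus3 (q : R) (A : set (C * C * C)) (f : C * C * C -> C) :=
  leb3.-integrable ((angles `*` angles `*` angles) `&` cis3 @^-1` A)
    (fun t => (modulus (f (cis3 t)) `^ q)%:E).

(* [powR] gives [0 `^ e = 0] for e < 0; here this value is +oo. *)
Definition pow_ereal (a e : R) : \bar R :=
  if (a == 0) && (e < 0) then +oo%E else (a `^ e)%:E.

(* The curve is given by lifts a, b of its two arguments. It is smooth and
   regular on the interior of the parameter interval; at an end point that
   belongs to it only continuity is required, so that a one-dimensional
   real-analytic set, which may have cusps, is a finite union of such curves.
   Closed curves are covered by half-open intervals. *)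
Definition smooth_curve (gamma : set (C * C)) : Prop :=
  exists (I : interval R) (a b : R -> R),
  [/\ [set` I]° !=set0,
      {within [set` I], continuous a} /\ {within [set` I], continuous b},
      forall t, [set` I]° t ->
        (forall n, derivable (derive1n n a) t 1 /\ derivable (derive1n n b) t 1) /\
        (derive1 a t != 0 \/ derive1 b t != 0),
      {in [set` I] &, injective (fun t => cis2 (a t, b t))} &
      gamma = [set cis2 (a t, b t) | t in [set` I]]].

(* For a real algebraic subset S of the two-dimensional torus: the dimension
   of S at each of its points is at least one (S contains smooth arcs
   arbitrarily close to the point) and less than two (S has no interior in
   the torus). *)
Definition pure_dimension_one (S : set (C * C)) : Prop :=
  forall z e, S z -> 0 < e ->
    (exists2 gamma, smooth_curve gamma & gamma `<=` S `&` ball2 z e) /\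
    ball2 z e `\` S !=set0.

Section RationalInner.
Variables (m1 m2 : nat).

Definition sigma (p1 p2 : mpolynomial 2 C) (z : C * C) : R :=
  modulus (eval2 (reflection (mdeg2 m1 m2) p1) z) ^+ 2
  - modulus (eval2 (reflection (mdeg2 m1 m2) p2) z) ^+ 2.

Definition rho_domain (p1 : mpolynomial 2 C) : set (C * C) :=
  [set z | torus2 z /\ eval2 (reflection (mdeg2 m1 m2) p1) z != 0].

Definition rho (p1 p2 : mpolynomial 2 C) (z : C * C) : R :=
  sigma p1 p2 z / modulus (eval2 (reflection (mdeg2 m1 m2) p1) z) ^+ 2.

Definition sigma_zeros (p1 p2 : mpolynomial 2 C) : set (C * C) :=
  [set z | torus2 z /\ sigma p1 p2 z = 0].

Definition rho_zeros (p1 p2 : mpolynomial 2 C) : set (C * C) :=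
  [set z | rho_domain p1 z /\ rho p1 p2 z = 0].

End RationalInner.

Definition vertical_line_singularity (p : mpolynomial 3 C) (xi : C * C) :=
  torus2 xi /\ forall xi3, circle xi3 -> eval3 p (xi, xi3) = 0.

Definition rif (m : multideg 3) (p : mpolynomial 3 C) (z : C * C * C) : C :=
  eval3 (reflection m p) z / eval3 p z.

Definition rif_dz3 (m : multideg 3) (p : mpolynomial 3 C) (z : C * C * C) : C :=
  derive1 (fun w : C => rif m p (z.1, w) : C^o) z.2.

Definition nonzeros (p : mpolynomial 3 C) : set (C * C * C) :=
  [set z | eval3 p z != 0].

(* The derivative is only defined off the zero set of p, which is a null
   subset of the torus. *)
Definition dz3_in_Lp (m : multideg 3) (p : mpolynomial 3 C) (q : R) : Prop :=
  Lp_on_torus3 q (torus3 `&` nonzeros p) (rif_dz3 m p).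

Definition dz3_in_Lp_loc (m : multideg 3) (p : mpolynomial 3 C) (q : R)
    (w : C * C * C) : Prop :=
  exists2 e : R, 0 < e &
    Lp_on_torus3 q (ball3 w e `&` nonzeros p) (rif_dz3 m p).

End Torus.

(* Main.v *)
(* On the torus, p~_j = z^m conj(p_j), so sigma = |p_1|^2 - |p_2|^2, which is
   nonnegative because stability forbids a zero -p_1/p_2 in the disk. Since |p_1|
   is bounded by some M, rho^(1-q) <= M^(2(q-1)) sigma^(1-q). Moreover
   |d phi / d z_3| = sigma / |p_1 + p_2 z_3|^2 is a Poisson kernel in z_3: its
   mean over the circle is bounded, and it is at most 4 M^2 / sigma, so the
   integral of its q-th power over the circle is O(sigma^(1-q)). By Tonelli the
   hypothesis gives local integrability along the whole vertical line, and the
   remaining equivalence follows from the compactness of the torus. *)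
Require Import Defs.
From HB Require Import structures.
From mathcomp Require Import all_boot all_order all_algebra.
From mathcomp Require Import complex.
From mathcomp Require Import -(notations) mpoly.
From mathcomp Require Import all_classical all_reals all_analysis.
From mathcomp Require Import measurable_realfun.
From mathcomp Require Import ring lra.

Import Order.TTheory GRing.Theory Num.Theory.
Import numFieldNormedType.Exports.

Local Open Scope classical_set_scope.
Local Open Scope ring_scope.

Set Implicit Arguments.
Unset Strict Implicit.
Unset Printing Implicit Defensive.

(** The exponent [1 - q] comes from the splitting x^q = x * x^(q-1) of the kernel x. One factor is
    kept for the mean over the circle, whose bound does not involve sigma, and only x^(q-1) is
    estimated by 4 M^2 / sigma; estimating all of x^q that way would lose one power of sigma. The
    mean itself is not computed: the kernel is dominated by a trigonometric polynomial with constant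
    term 2, so no series is integrated term by term and the fundamental theorem of calculus
    suffices. This accounts for the bound 2 * (2 pi) instead of 2 pi. Where sigma vanishes the
    kernel is replaced by zero, and the estimate survives because its right-hand side is
    nonnegative. Integration is done throughout on an explicit quotient in the angles, defined
    everywhere, with which the modulus of the derivative agrees off the zeros of p. *)

(** * The modulus and the unit circle *)

Section Modulus.
Context {R : realType}.
Implicit Types x y z : R[i].

Lemma norm_modulus z : `|z| = (modulus z)%:C%C.
Proof. by []. Qed.

Lemma modulus2E z : modulus z ^+ 2 = complex.Re z ^+ 2 + complex.Im z ^+ 2.
Proof. by case: z => a b; rewrite /modulus /= sqr_sqrtr// addr_ge0// sqr_ge0. Qed.

Lemma modulus_ge0 z : 0 <= modulus z.
Proof. by rewrite -lecR -norm_modulus normr_ge0. Qed.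

Lemma modulusM x y : modulus (x * y) = modulus x * modulus y.
Proof. exact: ComplexField.Normc.normcM. Qed.

Lemma modulusV x : modulus x^-1 = (modulus x)^-1.
Proof. exact: ComplexField.Normc.normcV. Qed.

Lemma modulus_eq0 z : (modulus z == 0) = (z == 0).
Proof.
apply/eqP/eqP => [/ComplexField.Normc.eq0_normc//|->].
exact: ComplexField.Normc.normc0.
Qed.

Lemma modulusJ z : modulus (conjc z) = modulus z.
Proof. by case: z => a b; rewrite /modulus /= sqrrN. Qed.

Lemma modulusX z n : modulus (z ^+ n) = modulus z ^+ n.
Proof.
elim: n => [|n IH]; first by rewrite !expr0 [LHS]ComplexField.Normc.normc1.
by rewrite !exprS modulusM IH.
Qed.

Lemma le_modulusD x y : modulus (x + y) <= modulus x + modulus y.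
Proof. exact: le_normcD. Qed.

Lemma modulusN x : modulus (- x) = modulus x.
Proof. exact: normcN. Qed.

Lemma ler_modulusB x y : modulus x - modulus y <= modulus (x + y).
Proof.
by rewrite lerBlDr; have := le_modulusD (x + y) (- y); rewrite addrK modulusN.
Qed.

Lemma modulus_sum (I : eqType) (r : seq I) (F : I -> R[i]) :
  modulus (\sum_(i <- r) F i) <= \sum_(i <- r) modulus (F i).
Proof.
elim: r => [|i r IH]; first by rewrite !big_nil [leLHS]ComplexField.Normc.normc0.
by rewrite !big_cons (le_trans (le_modulusD _ _))// lerD2l.
Qed.

Lemma modulus_prod (I : eqType) (r : seq I) (F : I -> R[i]) :
  modulus (\prod_(i <- r) F i) = \prod_(i <- r) modulus (F i).
Proof.
elim: r => [|i r IH]; first by rewrite !big_nil [LHS]ComplexField.Normc.normc1.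
by rewrite !big_cons modulusM IH.
Qed.

Lemma circleE z : circle z <-> modulus z = 1.
Proof. by rewrite /circle /= norm_modulus; split => [[]|->]. Qed.

Lemma circle_neq0 z : circle z -> z != 0.
Proof. by move=> /circleE z1; rewrite -modulus_eq0 z1 oner_eq0. Qed.

Lemma mulJc z : conjc z * z = ((modulus z) ^+ 2)%:C%C.
Proof.
rewrite modulus2E; case: z => a b; apply/eqP; rewrite eq_complex /=.
by apply/andP; split; apply/eqP; ring.
Qed.

(** On the circle the point at which a reflection evaluates its polynomial is the original one. *)
Lemma circle_invJ z : circle z -> (conjc z)^-1 = z.
Proof.
move=> cz; have := mulJc z; move/circleE : (cz) => ->; rewrite expr1n => h.
have cz0 : conjc z != 0 by rewrite conjc_eq0 circle_neq0.
by apply: (mulfI cz0); rewrite divff// h.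
Qed.

Lemma circle_cis (t : R) : circle (cis t).
Proof. by apply/circleE; rewrite /modulus /= cos2Dsin2 sqrtr1. Qed.

Lemma torus2_cis2 (t : R * R) : torus2 (cis2 t).
Proof. by split; exact: circle_cis. Qed.

Lemma torus3_cis3 (t : R * R * R) : torus3 (cis3 t).
Proof. by split; [exact: torus2_cis2|exact: circle_cis]. Qed.

End Modulus.

(** * Coefficients and degrees of [p1 + p2 * z3] *)

Section Widening.
Context {R : rcfType}.
Local Notation C := R[i].
Variables (p1 p2 : mpolynomial 2 C).

Let p : mpolynomial 3 C :=
  mpoly.mwiden p1 + mpoly.mwiden p2 * mpoly.mpolyX C (mpoly.mnm1 ord_max).

Lemma mwiden_sum (s : mpolynomial 2 C) : mpoly.mwiden s =
  \sum_(k <- mpoly.msupp s) mpoly.mcoeff k s *: mpoly.mpolyX C (mpoly.mnmwiden k).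
Proof.
rewrite {1}(mpoly.mpolyE s) (raddf_sum (@mpoly.mwiden _ _)).
by apply: eq_bigr => k _ /=; rewrite mpoly.mwidenZ mpoly.mwidenX.
Qed.

Lemma meval_mwiden (s : mpolynomial 2 C) (z : C * C) (w : C) :
  eval3 (mpoly.mwiden s) (z, w) = eval2 s z.
Proof.
rewrite /eval3 /eval2 mwiden_sum (raddf_sum (mpoly.meval _)) (mpoly.mevalE _ s).
apply: eq_bigr => k _ /=; rewrite mpoly.mevalZ mpoly.mevalX big_ord_recr /=.
rewrite mpoly.mnmwiden_ordmax expr0 mulr1; congr (_ * _).
apply: eq_bigr => i _; rewrite mpoly.mnmwiden_widen; congr (_ ^+ _).
by case: i => [[|[|]]].
Qed.

Lemma eval3_affine (z : C * C) (w : C) :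
  eval3 p (z, w) = eval2 p1 z + eval2 p2 z * w.
Proof.
have ev s := meval_mwiden s z w; rewrite /eval3 in ev.
rewrite /p /eval3 mpoly.mevalD mpoly.mevalM mpoly.mevalXU.
by congr (_ + _ * _); [exact: (ev p1)|exact: (ev p2)].
Qed.

(** Monomials of the second summand have exponent 1 in the last variable and widened ones have
    exponent 0, so the two summands cannot cancel. *)
Lemma mcoeff_low (k : multideg 2) :
  mpoly.mcoeff (mpoly.mnmwiden k) p = mpoly.mcoeff k p1.
Proof.
rewrite mpoly.mcoeffD mpoly.mwiden_mnmwiden (mwiden_sum p2) mulr_suml.
rewrite (raddf_sum (mpoly.mcoeff _)) big1 ?addr0// => m _.
rewrite /= -mpoly.mul_mpolyC -mulrA -mpoly.mpolyXD mpoly.mcoeffCM mpoly.mcoeffX.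
case: eqP => [/(congr1 (fun u => mpoly.fun_of_multinom u ord_max))|_]; last first.
    by rewrite mulr0.
by rewrite mpoly.mnmDE !mpoly.mnmwiden_ordmax mpoly.mnm1E eqxx.
Qed.

Lemma mcoeff_high (k : multideg 2) :
  mpoly.mcoeff (mpoly.mnm_add (mpoly.mnmwiden k) (mpoly.mnm1 ord_max)) p
  = mpoly.mcoeff k p2.
Proof.
rewrite mpoly.mcoeffD (mwiden_sum p1).
rewrite (raddf_sum (mpoly.mcoeff _)) /= big1 ?add0r; last first.
  move=> m _; rewrite mpoly.mcoeffZ mpoly.mcoeffX.
  case: eqP => [/(congr1 (fun u => mpoly.fun_of_multinom u ord_max))|_]; last first.
    by rewrite mulr0.
  by rewrite mpoly.mnmDE !mpoly.mnmwiden_ordmax mpoly.mnm1E eqxx.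
by rewrite mpoly.addmC mpoly.mcoeffMX mpoly.mwiden_mnmwiden.
Qed.

Lemma deg_in_msupp n (s : mpolynomial n C) (k : multideg n) (i : 'I_n) :
  k \in mpoly.msupp s -> (mpoly.fun_of_multinom k i <= deg_in s i)%N.
Proof. by move=> ks; rewrite /deg_in (big_rem k)//= leq_maxl. Qed.

Lemma deg_in_le n (s : mpolynomial n C) (i : 'I_n) (d : nat) :
  (forall k, k \in mpoly.msupp s -> (mpoly.fun_of_multinom k i <= d)%N) ->
  (deg_in s i <= d)%N.
Proof.
by move=> sd; rewrite /deg_in big_seq; apply/bigmax_leqP_seq => k ks _; exact: sd.
Qed.

Variables (m1 m2 : nat).
Hypothesis dp : has_polydegree p (mdeg3 m1 m2 1).

(** The reflections of [p1] and [p2] are taken with respect to the bidegree of [p], which may exceed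
    their own; this bound is what [reflectionE] asks for. It holds since the support of [p1] embeds
    into that of [p]. *)
Lemma deg_in_low (i : 'I_2) :
  (deg_in p1 i <= mpoly.fun_of_multinom (mdeg2 m1 m2) i)%N.
Proof.
apply: deg_in_le => k kp1.
have : mpoly.mnmwiden k \in mpoly.msupp p.
  by rewrite mpoly.mcoeff_msupp mcoeff_low -mpoly.mcoeff_msupp.
move/(@deg_in_msupp _ _ _ (widen_ord (leqnSn 2) i)); rewrite dp mpoly.mnmwiden_widen.
by move/leq_trans; apply; case: i => [[|[|]]].
Qed.

Lemma deg_in_high (i : 'I_2) :
  (deg_in p2 i <= mpoly.fun_of_multinom (mdeg2 m1 m2) i)%N.
Proof.
apply: deg_in_le => k kp2.
have : mpoly.mnm_add (mpoly.mnmwiden k) (mpoly.mnm1 ord_max) \in mpoly.msupp p.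
  by rewrite mpoly.mcoeff_msupp mcoeff_high -mpoly.mcoeff_msupp.
move/(@deg_in_msupp _ _ _ (widen_ord (leqnSn 2) i)).
rewrite dp mpoly.mnmDE mpoly.mnmwiden_widen.
move=> h; apply: (leq_trans (leq_addr _ _)); apply: (leq_trans h).
by case: i h => [[|[|]]].
Qed.

End Widening.

(* [R[i]] has no measurable structure, so measurability (and, likewise,
   continuity) of complex-valued functions is handled through the real and
   imaginary parts, for any class S of real functions closed under sums and
   products. *)
Section ClosedFunctions.
Context {R : realType} (T : Type) (S : (T -> R) -> Prop).
Hypothesis S_cst : forall c, S (fun=> c).
Hypothesis S_add : forall f g, S f -> S g -> S (fun t => f t + g t).
Hypothesis S_mul : forall f g, S f -> S g -> S (fun t => f t * g t).

Definition complex_in (f : T -> R[i]) :=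
  S (fun t => complex.Re (f t)) /\ S (fun t => complex.Im (f t)).

Lemma complex_in_ext f g : f =1 g -> complex_in f -> complex_in g.
Proof. by move=> /funext ->. Qed.

Lemma complex_in_cst c : complex_in (fun=> c).
Proof. by split; exact: S_cst. Qed.

Lemma complex_inD f g :
  complex_in f -> complex_in g -> complex_in (fun t => f t + g t).
Proof.
move=> [fr fi] [gr gi]; split.
- rewrite [X in S X](_ : _ = fun t => complex.Re (f t) + complex.Re (g t)).
    exact: S_add.
  by apply/funext => t; case: (f t) (g t) => [? ?] [].
- rewrite [X in S X](_ : _ = fun t => complex.Im (f t) + complex.Im (g t)).
    exact: S_add.
  by apply/funext => t; case: (f t) (g t) => [? ?] [].
Qed.

Lemma complex_inM f g :
  complex_in f -> complex_in g -> complex_in (fun t => f t * g t).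
Proof.
move=> [fr fi] [gr gi]; split.
- rewrite [X in S X](_ : _ = fun t => complex.Re (f t) * complex.Re (g t)
      + (-1) * (complex.Im (f t) * complex.Im (g t))).
    by apply: S_add; apply: S_mul => //; exact: S_mul.
  by apply/funext => t; rewrite mulN1r; case: (f t) (g t) => [? ?] [].
- rewrite [X in S X](_ : _ = fun t => complex.Re (f t) * complex.Im (g t)
      + complex.Im (f t) * complex.Re (g t)).
    by apply: S_add; exact: S_mul.
  by apply/funext => t; case: (f t) (g t) => [? ?] [? ?].
Qed.

Lemma complex_inX f n : complex_in f -> complex_in (fun t => f t ^+ n).
Proof.
move=> Sf; elim: n => [|n IH]; first by apply: complex_in_ext (complex_in_cst 1).
by apply: complex_in_ext (complex_inM Sf IH) => t; rewrite exprS.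
Qed.

Lemma complex_in_meval n (s : mpolynomial n R[i]) (z : T -> 'I_n -> R[i]) :
  (forall i, complex_in (z ^~ i)) -> complex_in (fun t => mpoly.meval (z t) s).
Proof.
move=> Sz; apply: (@complex_in_ext (fun t => \sum_(m <- mpoly.msupp s)
  mpoly.mcoeff m s * \prod_i z t i ^+ mpoly.fun_of_multinom m i)).
  by move=> t; rewrite mpoly.mevalE.
elim: (mpoly.msupp s : seq _) => [|m r IH].
  by apply: complex_in_ext (complex_in_cst 0) => t; rewrite big_nil.
apply: (@complex_in_ext (fun t => mpoly.mcoeff m s *
  \prod_i z t i ^+ mpoly.fun_of_multinom m i + \sum_(m <- r)
  mpoly.mcoeff m s * \prod_i z t i ^+ mpoly.fun_of_multinom m i)).
  by move=> t; rewrite big_cons.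
apply: complex_inD => //; apply: complex_inM; first exact: complex_in_cst.
elim: (index_enum 'I_n) => [|i e IHe].
  by apply: complex_in_ext (complex_in_cst 1) => t; rewrite big_nil.
apply: (@complex_in_ext (fun t => z t i ^+ mpoly.fun_of_multinom m i *
  \prod_(j <- e) z t j ^+ mpoly.fun_of_multinom m j)).
  by move=> t; rewrite big_cons.
by apply: complex_inM => //; exact: complex_inX.
Qed.

(** The square is a polynomial in the real and imaginary parts, while the modulus needs a square
    root, which closure under sums and products does not give. Hence the squared moduli in all later
    measurability statements. *)
Lemma complex_in_modulus2 f : complex_in f -> S (fun t => modulus (f t) ^+ 2).
Proof.
move=> [fr fi].
rewrite [X in S X](_ : _ = fun t => complex.Re (f t) * complex.Re (f t)
    + complex.Im (f t) * complex.Im (f t)).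
  by apply: S_add; exact: S_mul.
by apply/funext => t; rewrite modulus2E.
Qed.

End ClosedFunctions.

(** * Values on the torus and the sign of sigma *)

Section TorusValues.
Context {R : realType}.
Local Notation C := R[i].
Variables (m1 m2 : nat).

Lemma eval2_reflection (s : mpolynomial 2 C) (z : C * C) :
  (forall i, (deg_in s i <= mpoly.fun_of_multinom (mdeg2 m1 m2) i)%N) ->
  torus2 z ->
  eval2 (reflection (mdeg2 m1 m2) s) z
  = z.1 ^+ m1 * z.2 ^+ m2 * conjc (eval2 s z).
Proof.
move=> ds [z1 z2]; rewrite /eval2 (reflectionE ds); last first.
  by case=> [[|[|]]]//= ?; exact: circle_neq0.
rewrite 2!big_ord_recr big_ord0 /= mul1r; congr (_ * conjc _).
apply: mpoly.meval_eq; case=> [[|[|]]]//= ?; exact: circle_invJ.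
Qed.

Lemma modulus_eval2_reflection (s : mpolynomial 2 C) (z : C * C) :
  (forall i, (deg_in s i <= mpoly.fun_of_multinom (mdeg2 m1 m2) i)%N) ->
  torus2 z ->
  modulus (eval2 (reflection (mdeg2 m1 m2) s) z) = modulus (eval2 s z).
Proof.
move=> ds tz; rewrite eval2_reflection//; case: tz => /circleE z1 /circleE z2.
by rewrite !modulusM !modulusX z1 z2 !expr1n !mul1r modulusJ.
Qed.

Lemma eval2_bounded (s : mpolynomial 2 C) :
  exists2 M : R, 0 < M & forall z, torus2 z -> modulus (eval2 s z) <= M.
Proof.
exists (1 + \sum_(k <- mpoly.msupp s) modulus (mpoly.mcoeff k s)).
  by rewrite ltr_wpDr// sumr_ge0// => k _; exact: modulus_ge0.
move=> z [/circleE z1 /circleE z2]; apply: ler_wpDl => //.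
rewrite /eval2 mpoly.mevalE (le_trans (modulus_sum _ _))//.
apply: ler_sum => k _; rewrite modulusM modulus_prod big1 ?mulr1// => i _.
rewrite modulusX (_ : modulus _ = 1) ?expr1n//.
by case: i => [[|[|]]].
Qed.

Variables (p1 p2 : mpolynomial 2 C).
Let p : mpolynomial 3 C :=
  mpoly.mwiden p1 + mpoly.mwiden p2 * mpoly.mpolyX C (mpoly.mnm1 ord_max).

Lemma stable_disk (z : C * C) : stable p -> `|z.1| < 1 -> `|z.2| < 1 ->
  modulus (eval2 p2 z) <= modulus (eval2 p1 z).
Proof.
move=> sp z1 z2; rewrite leNgt; apply/negP => lt12.
have b0 : eval2 p2 z != 0.
  by rewrite -modulus_eq0 gt_eqF// (le_lt_trans _ lt12)// modulus_ge0.
have w1 : `|- (eval2 p1 z / eval2 p2 z)| < 1.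
  rewrite normrN norm_modulus modulusM modulusV (ltcR _ 1).
  by rewrite ltr_pdivrMr ?mul1r// (le_lt_trans _ lt12)// modulus_ge0.
have := sp (z, _) z1 z2 w1.
by rewrite eval3_affine mulrN mulrCA divff// mulr1 subrr eqxx.
Qed.

(** Stability speaks of the open polydisk only; the weak inequality passes to the torus by a radial
    limit. *)
Lemma stable_torus (z : C * C) : stable p -> torus2 z ->
  modulus (eval2 p2 z) <= modulus (eval2 p1 z).
Proof.
move=> sp [z1 z2].
rewrite -(@ler_pXn2r _ 2)// ?nnegrE ?modulus_ge0// -subr_ge0.
(* For 0 <= r < 1 the point r z lies in the bidisk. The difference is written with a factor -1 so
   that continuity follows from closure under sums and products. *)
pose f (r : R) : R := modulus (eval2 p1 (r%:C%C * z.1, r%:C%C * z.2)) ^+ 2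
  + (-1) * modulus (eval2 p2 (r%:C%C * z.1, r%:C%C * z.2)) ^+ 2.
have f1 : modulus (eval2 p1 z) ^+ 2 - modulus (eval2 p2 z) ^+ 2 = f 1.
  by rewrite /f !mul1r mulN1r -surjective_pairing.
have cD (g h : R -> R) : continuous g -> continuous h -> continuous (fun t => g t + h t).
  by move=> cg ch x; apply: cvgD; [exact: cg|exact: ch].
have cM (g h : R -> R) : continuous g -> continuous h -> continuous (fun t => g t * h t).
  by move=> cg ch x; apply: cvgM; [exact: cg|exact: ch].
have cC (c : R) : continuous (fun _ : R => c) by move=> x; exact: cvg_cst.
have ce s : continuous (fun r : R => modulus (eval2 s (r%:C%C * z.1, r%:C%C * z.2)) ^+ 2).
  apply: (@complex_in_modulus2 _ _ (fun g : R -> R => continuous g)) => //.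
  apply: complex_in_meval => //.
  have cr : complex_in (fun g : R -> R => continuous g) (fun r => r%:C%C).
    by split => [x|]; [exact: cvg_id|exact: cC].
  by case=> [[|[|]]]//= ?; apply: complex_inM => //; apply: complex_in_cst.
have cf : continuous f by apply: cD => //; exact: cM.
rewrite f1; apply: (@cvgr_to_ge _ (1 : R)^'- _ _ f).
- exact: (cvg_at_left_filter (cf 1)).
- near=> r.
  have r0 : 0 <= r by near: r; apply: nbhs_left_ge.
  rewrite /f mulN1r subr_ge0 ler_pXn2r// ?nnegrE ?modulus_ge0//.
  have r1 : r < 1 by [].
  have cr1 : `|r%:C%C : C| < 1 by rewrite ger0_norm ?(ltcR _ 1)// lecR.
  by apply: stable_disk => //=; rewrite normrM ?z1 ?z2 mulr1.
Unshelve. all: end_near. Qed.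

Hypothesis dp : has_polydegree p (mdeg3 m1 m2 1).

Lemma sigmaE (z : C * C) : torus2 z -> sigma m1 m2 p1 p2 z =
  modulus (eval2 p1 z) ^+ 2 - modulus (eval2 p2 z) ^+ 2.
Proof.
move=> tz; rewrite /sigma !modulus_eval2_reflection//.
  exact: deg_in_high dp.
exact: deg_in_low dp.
Qed.

(** The last variable ranges over all nonzero numbers and not just the circle, because the formula
    is differentiated in that variable and must hold on a complex neighbourhood. *)
Lemma eval3_reflection (z : C * C) (w : C) : torus2 z -> w != 0 ->
  eval3 (reflection (mdeg3 m1 m2 1) p) (z, w) =
  z.1 ^+ m1 * z.2 ^+ m2 * (conjc (eval2 p1 z) * w + conjc (eval2 p2 z)).
Proof.
move=> [z1 z2] w0; rewrite /eval3 reflectionE; last 2 first.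
- by move=> i; rewrite dp.
- by case=> [[|[|[|]]]]//= ?; exact: circle_neq0.
rewrite 3!big_ord_recr big_ord0 /= mul1r /= expr1 -mulrA; congr (_ * _).
rewrite (@mpoly.meval_eq _ _ _ (tnth [tuple z.1; z.2; (conjc w)^-1])); last first.
  by case=> [[|[|[|]]]]//= ?; exact: circle_invJ.
have /= := eval3_affine p1 p2 z (conjc w)^-1; rewrite /eval3 /= => ->.
rewrite rmorphD rmorphM fmorphV /= conjcK mulrDr; congr (_ + _); first exact: mulrC.
by rewrite mulrCA divff// mulr1.
Qed.

End TorusValues.

(** * The derivative in the third variable *)

(** For fixed torus values of the first two variables phi is a homography in the third; its
    determinant [A * a - B * b] becomes sigma up to a unimodular factor. *)
Lemma derive1_homography (K : numFieldType) (A B a b w : K) :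
  a + b * w != 0 ->
  derive1 (fun z : K => (A * z + B) / (a + b * z) : K^o) w
  = (A * a - B * b) / (a + b * w) ^+ 2.
Proof.
move=> D0.
have dlin (u v : K) : is_derive (w : K^o) (1 : K^o) (fun z : K^o => u * z + v : K^o) u.
  rewrite -[u in is_derive _ _ _ u]addr0 -[X in X + 0]mulr1.
  exact: is_deriveD.
have dA := dlin A B; have dB := dlin b a.
have D0' : b * w + a != 0 by rewrite addrC.
have dV : is_derive (w : K^o) (1 : K^o) (fun z : K^o => (b * z + a)^-1 : K^o)
    (- (b * w + a) ^- 2 *: (b : K^o)).
  apply: DeriveDef; first by apply: derivableV => //; exact: ex_derive.
  by rewrite deriveV//; congr (_ *: _); exact: derive_val.
have -> : (fun z : K => (A * z + B) / (a + b * z) : K^o) =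
    (fun z : K^o => A * z + B : K^o) * (fun z : K^o => (b * z + a)^-1 : K^o).
  by apply/funext => z; rewrite [a + _]addrC.
have dM := is_deriveM dA dV.
rewrite derive1E derive_val /GRing.scale /=.
by rewrite [b * w + a]addrC; field.
Qed.

Section Derivative.
Context {R : realType}.
Local Notation C := R[i].
Variables (m1 m2 : nat) (p1 p2 : mpolynomial 2 C).
Let p : mpolynomial 3 C :=
  mpoly.mwiden p1 + mpoly.mwiden p2 * mpoly.mpolyX C (mpoly.mnm1 ord_max).
Hypothesis dp : has_polydegree p (mdeg3 m1 m2 1).

Lemma rif_dz3E (z : C * C) (w : C) : torus2 z -> circle w ->
  eval3 p (z, w) != 0 ->
  rif_dz3 (mdeg3 m1 m2 1) p (z, w) = z.1 ^+ m1 * z.2 ^+ m2 *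
    ((modulus (eval2 p1 z) ^+ 2)%:C%C - (modulus (eval2 p2 z) ^+ 2)%:C%C)
    / eval3 p (z, w) ^+ 2.
Proof.
move=> tz cw pz; set c := z.1 ^+ m1 * z.2 ^+ m2.
have pE v : eval3 p (z, v) = eval2 p1 z + eval2 p2 z * v := eval3_affine p1 p2 z v.
rewrite /rif_dz3 derive1E /=.
(* A derivative depends only on the germ, so agreement with the homography for [v != 0], which holds
   near [w], is enough. *)
rewrite (@near_eq_derive _ C^o C^o _ (fun v : C =>
  (c * conjc (eval2 p1 z) * v + c * conjc (eval2 p2 z))
  / (eval2 p1 z + eval2 p2 z * v) : C^o)); last first.
  have : \forall v \near (w : C^o), v != 0.
    exact: (@cvgr_neq0 _ C^o _ (nbhs (w : C^o)) _ idfun (w : C^o) cvg_id (circle_neq0 cw)).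
  apply: filterS => v v0.
  by rewrite /rif eval3_reflection// pE mulrDr mulrA.
have D0 : eval2 p1 z + eval2 p2 z * w != 0 by rewrite -pE.
have := derive1_homography (c * conjc (eval2 p1 z)) (c * conjc (eval2 p2 z)) D0.
rewrite derive1E => ->; rewrite -pE; congr (_ / _).
by rewrite -!mulJc; ring.
Qed.

Lemma modulus_rif_dz3 (z : C * C) (w : C) : torus2 z -> circle w ->
  eval3 p (z, w) != 0 ->
  modulus (rif_dz3 (mdeg3 m1 m2 1) p (z, w)) =
  `|modulus (eval2 p1 z) ^+ 2 - modulus (eval2 p2 z) ^+ 2|
  / modulus (eval3 p (z, w)) ^+ 2.
Proof.
move=> tz cw pz; rewrite rif_dz3E//; case: tz => /circleE z1 /circleE z2.
rewrite modulusM modulusV modulusX; congr (_ / _).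
rewrite !modulusM !modulusX z1 z2 !expr1n !mul1r -rmorphB.
by rewrite /modulus /= expr0n addr0 sqrtr_sqr.
Qed.

End Derivative.

(** * The Poisson kernel and a trigonometric majorant *)

Section PoissonKernel.
Context {R : realType}.
Local Notation C := R[i].

Lemma cisX (t : R) n : cis t ^+ n = cis (n%:R * t).
Proof.
elim: n => [|n IH]; first by rewrite expr0 mul0r /cis cos0 sin0.
rewrite exprS IH -natr1 mulrDl mul1r addrC /cis cosD sinD.
by apply/eqP; rewrite eq_complex /=; apply/andP; split; apply/eqP; ring.
Qed.

Lemma cis_2pi n : cis (n%:R * (2 * pi)) = 1 :> C.
Proof. by rewrite -cisX /cis mulr_natl cos2pi sin2pi expr1n. Qed.

Lemma Re_mul_cis (c : C) (t : R) :
  complex.Re (c * cis t) = complex.Re c * cos t - complex.Im c * sin t.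
Proof. by case: c. Qed.

Lemma le_Re_modulus (z : C) : complex.Re z <= modulus z.
Proof.
case: z => a b; rewrite /modulus /= (le_trans (ler_norm _))// -sqrtr_sqr.
by rewrite ler_wsqrtr// lerDl sqr_ge0.
Qed.

Lemma is_derive_antiderivative_cis (c : C) (m : nat) (t : R) : (0 < m)%N ->
  is_derive t 1 (fun t => (complex.Re c * sin (m%:R * t)
    + complex.Im c * cos (m%:R * t)) / m%:R) (complex.Re (c * cis (m%:R * t))).
Proof.
move=> m0; have mE : (m%:R : R) != 0 by rewrite pnatr_eq0 -lt0n.
have dm : is_derive t 1 (fun t : R => m%:R * t) m%:R.
  rewrite -[X in is_derive _ _ _ X]mulr1; exact: is_deriveZ.
have ds := is_derive1_comp (is_derive_sin (m%:R * t)) dm.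
have dc := is_derive1_comp (is_derive_cos (m%:R * t)) dm.
have -> : (fun t => (complex.Re c * sin (m%:R * t)
    + complex.Im c * cos (m%:R * t)) / m%:R) =
   (m%:R)^-1 \*: ((complex.Re c \*: (sin \o (fun t : R => m%:R * t)))
    + (complex.Im c \*: (cos \o (fun t : R => m%:R * t)))).
  by apply/funext => u /=; rewrite mulrC.
apply: is_derive_eq; rewrite Re_mul_cis /GRing.scale /=.
by field.
Qed.

(** All frequencies [k.+1] are nonzero, so the oscillating terms have 2 pi-periodic antiderivatives
    and only the constant contributes. *)
Lemma integral_trigonometric_polynomial (d : R) (c : nat -> C) (n : nat) :
  (\int[lebesgue_measure]_(t in `[0%R, (2 * pi)%R])
    (d + \sum_(k < n) complex.Re (c k * cis (k.+1%:R * t)))%:E)%E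
  = (d * (2 * pi))%:E.
Proof.
pose h (k : nat) (t : R) := (complex.Re (c k) * sin (k.+1%:R * t)
    + complex.Im (c k) * cos (k.+1%:R * t)) / k.+1%:R.
pose F (t : R) := d * t + \sum_(k < n) h k t.
pose f (t : R) := d + \sum_(k < n) complex.Re (c k * cis (k.+1%:R * t)).
have dF (t : R) : is_derive t 1 F (f t).
  have -> : F = (fun t => d * t) + \sum_(k < n) h k.
    by apply/funext => u; rewrite /F fctE fct_sumE.
  apply: is_deriveD; first by rewrite -[X in is_derive _ _ _ X]mulr1; exact: is_deriveZ.
  by apply: is_derive_sum => i; exact: is_derive_antiderivative_cis.
have cF : continuous F.
  move=> t; apply: differentiable_continuous; apply/derivable1_diffP.
  exact: ex_derive.
have cc (a : R) : continuous (fun t : R => a * t).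
  by move=> t; apply: cvgM; [exact: cvg_cst|exact: cvg_id].
have cf : continuous f.
  move=> t; apply: cvgD; first exact: cvg_cst.
  apply: cvg_big => [|k _]; first exact: add_continuous.
  rewrite [X in X @ _](_ : _ = fun t =>
    complex.Re (c k) * cos (k.+1%:R * t) - complex.Im (c k) * sin (k.+1%:R * t)); last first.
    by apply/funext => u; exact: Re_mul_cis.
  rewrite Re_mul_cis.
  apply: cvgB; apply: cvgM; try exact: cvg_cst.
    by apply: (continuous_comp (cc _ t)); exact: continuous_cos.
  by apply: (continuous_comp (cc _ t)); exact: continuous_sin.
rewrite (@continuous_FTC2 R f F 0 (2 * pi)).
- rewrite -EFinB /F mulr0 add0r -addrA -sumrB big1 ?addr0// => k _.
  (* Equality with 1 in [R[i]] splits into the values of the cosine and of the sine. *)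
  have [c1 s0] := cis_2pi k.+1.
  by rewrite /h c1 s0 !mulr0 cos0 sin0 !mulr0 subrr.
- by rewrite mulr_gt0// pi_gt0.
- exact: continuous_subspaceT.
- split => [x _||]; first exact: ex_derive.
    exact/cvg_at_right_filter/cF.
  exact/cvg_at_left_filter/cF.
- by move=> x _; rewrite derive1E; exact: derive_val.
Qed.

(** The expansion of (1 + w) / (1 - w) as 1 + 2 w + 2 w^2 + ..., cut off with its exact
    remainder. *)
Lemma geometric_remainder (w : C) n : w != 1 ->
  (1 + w) / (1 - w) = 1 + \sum_(k < n) 2 * w ^+ k.+1 + 2 * (w ^+ n.+1 / (1 - w)).
Proof.
move=> w1; have w0 : 1 - w != 0 by rewrite subr_eq0 eq_sym.
elim: n => [|n IH]; first by rewrite big_ord0; field.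
rewrite IH big_ord_recr /= [w ^+ n.+2]exprS; field.
by [].
Qed.

(** Expanding the fraction by the conjugate of 1 - w leaves the numerator (1 + w) * conj (1 - w),
    whose real part is 1 - |w|^2. *)
Lemma poisson_kernelE (w : C) : w != 1 ->
  (1 - modulus w ^+ 2) / modulus (1 - w) ^+ 2 = complex.Re ((1 + w) / (1 - w)).
Proof.
move=> w1; have w0 : modulus (1 - w) ^+ 2 != 0.
  by rewrite sqrf_eq0 modulus_eq0 subr_eq0 eq_sym.
have -> : (1 + w) / (1 - w) = (1 + w) * conjc (1 - w) * (modulus (1 - w) ^- 2)%:C%C.
  rewrite -mulrA; congr (_ * _).
  have w0' : 1 - w != 0 by rewrite subr_eq0 eq_sym.
  apply: (mulIf w0'); rewrite mulVf// mulrAC mulJc -rmorphM /= divff//.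
rewrite modulus2E; move: (modulus _ ^+ 2) w0 => u u0.
by case: w {w1} => x y /=; field.
Qed.

(** The geometric expansion is truncated once its remainder is at most 1, uniformly in [t]; that 1
    and the constant term of the kernel make up the 2. *)
Lemma poisson_kernel_majorant (r : C) : modulus r < 1 ->
  exists n, forall t : R,
  (1 - modulus (r * cis t) ^+ 2) / modulus (1 - r * cis t) ^+ 2
  <= 2 + \sum_(k < n) complex.Re (2 * r ^+ k.+1 * cis (k.+1%:R * t)).
Proof.
move=> r1; have r1' : 0 < 1 - modulus r by rewrite subr_gt0.
(* Since |1 - w| >= 1 - |r|, this choice brings the remainder 2 |w|^(n+1) / |1 - w| below 1. *)
have [n rn] : exists n, modulus r ^+ n <= 2^-1 * (1 - modulus r).
  have rn0 : modulus r ^+ n @[n --> \oo] --> (0 : R).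
    by apply: cvg_expr; rewrite ger0_norm ?modulus_ge0.
  have e0 : 0 < 2^-1 * (1 - modulus r) by rewrite mulr_gt0// invr_gt0.
  have /= [n _ hn] := @cvgr0_norm_le _ R^o _ _ _ _ rn0 _ e0.
  exists n; apply: le_trans (hn n _); last exact: leqnn.
  exact: ler_norm.
exists n => t; set w := r * cis t.
have wr : modulus w = modulus r.
  by rewrite /w modulusM ((circleE (cis t)).1 (circle_cis t)) mulr1.
have w1 : w != 1.
  by apply/eqP => w1; move: r1; rewrite -wr w1 [modulus 1]ComplexField.Normc.normc1 ltxx.
rewrite poisson_kernelE// (geometric_remainder n)//.
have ReD (x y : C) : complex.Re (x + y) = complex.Re x + complex.Re y.
  by case: x y => ? ? [].
have -> : \sum_(k < n) complex.Re (2 * r ^+ k.+1 * cis (k.+1%:R * t)) =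
    complex.Re (\sum_(k < n) 2 * w ^+ k.+1).
  rewrite (big_morph (@complex.Re R) ReD erefl); apply: eq_bigr => k _.
  by rewrite /w exprMn cisX mulrA.
rewrite !ReD addrAC lerD2r.
suff : complex.Re (2 * (w ^+ n.+1 / (1 - w))) <= 1.
  by move=> h; rewrite -[leRHS]/(1 + 1) lerD2l.
apply: (le_trans (le_Re_modulus _)); rewrite modulusM modulusM modulusX modulusV wr.
have -> : modulus (2 : C) = 2.
  by rewrite /modulus /= !addr0 expr0n addr0 sqrtr_sqr ger0_norm.
have d : 1 - modulus r <= modulus (1 - w).
  have := ler_modulusB 1 (- w).
  by rewrite modulusN wr [modulus 1]ComplexField.Normc.normc1.
have d0 : 0 < modulus (1 - w) by exact: lt_le_trans d.
rewrite mulrA ler_pdivrMr// mul1r (le_trans _ d)//.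
rewrite -ler_pdivlMl// (le_trans _ rn)// exprS ler_piMl ?exprn_ge0 ?modulus_ge0//.
exact: ltW.
Qed.

End PoissonKernel.

(** * Measurability in the angles *)

Section Measurability.
Context {R : realType} {d : measure_display} {T : measurableType d}.
Local Notation C := R[i].
Let mf (f : T -> R) := measurable_fun setT f.

Let mcst c : mf (fun=> c). Proof. exact: measurable_cst. Qed.
Let madd f g : mf f -> mf g -> mf (fun t => f t + g t).
Proof. exact: measurable_funD. Qed.
Let mmul f g : mf f -> mf g -> mf (fun t => f t * g t).
Proof. exact: measurable_funM. Qed.

(** Inversion is the power -1 on nonnegative reals, also at 0, where both conventions give 0. *)
Lemma measurable_invr (f : T -> R) : (forall t, 0 <= f t) ->
  measurable_fun setT f -> measurable_fun setT (fun t => (f t)^-1).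
Proof.
move=> f0 hf; rewrite [X in measurable_fun _ X](_ : _ = (powR (R:=R))^~ (-1) \o f).
  exact: measurableT_comp (measurable_powR _) hf.
by apply/funext => t /=; rewrite powR_inv1.
Qed.

Lemma measurable_pow_ereal (e : R) (f : T -> R) :
  measurable_fun setT f -> measurable_fun setT (fun t => pow_ereal (f t) e).
Proof.
move=> hf; have mp : measurable_fun setT (fun t => (f t `^ e)%:E).
  apply/measurable_EFinP; exact: measurableT_comp (measurable_powR _) hf.
rewrite /pow_ereal; case: (e < 0).
  under eq_fun do rewrite andbT.
  apply: measurable_fun_ifT => //.
  by apply: measurable_fun_eqr.
by under eq_fun do rewrite andbF.
Qed.

Lemma measurable_cis (h : T -> R) :
  measurable_fun setT h -> complex_in mf (fun t => cis (h t)).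
Proof.
move=> mh; split; apply: measurableT_comp mh; apply: continuous_measurable_fun.
  exact: continuous_cos.
exact: continuous_sin.
Qed.

Lemma measurable_dist2 (h : T -> R) (c : C) : measurable_fun setT h ->
  measurable_fun setT (fun t => modulus (cis (h t) - c) ^+ 2).
Proof.
move=> mh; apply: (@complex_in_modulus2 _ _ mf) => //.
apply: (@complex_inD _ _ mf madd); first exact: measurable_cis.
exact: complex_in_cst.
Qed.

Lemma measurable_eval2 (s : mpolynomial 2 C) (h1 h2 : T -> R) :
  measurable_fun setT h1 -> measurable_fun setT h2 ->
  measurable_fun setT (fun t => modulus (eval2 s (cis2 (h1 t, h2 t))) ^+ 2).
Proof.
move=> m1 m2; apply: (@complex_in_modulus2 _ _ mf) => //.
by apply: complex_in_meval => //; case=> [[|[|]]]//= ?; exact: measurable_cis.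
Qed.

Lemma measurable_eval3 (s : mpolynomial 3 C) (h1 h2 h3 : T -> R) :
  measurable_fun setT h1 -> measurable_fun setT h2 -> measurable_fun setT h3 ->
  measurable_fun setT (fun t => modulus (eval3 s (cis3 (h1 t, h2 t, h3 t))) ^+ 2).
Proof.
move=> m1 m2 m3; apply: (@complex_in_modulus2 _ _ mf) => //.
by apply: complex_in_meval => //; case=> [[|[|[|]]]]//= ?; exact: measurable_cis.
Qed.

Lemma measurable_set_lt (f : T -> R) (c : R) :
  measurable_fun setT f -> measurable [set t | f t < c].
Proof.
move=> mf'; have := mf' measurableT `]-oo, c[%classic (measurable_itv _).
by rewrite setTI.
Qed.

Lemma measurable_set_neq0 (f : T -> R) :
  measurable_fun setT f -> measurable [set t | f t != 0].
Proof.
move=> mf'; have := mf' measurableT (~` [set 0]) (measurableC (measurable_set1 _)).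
rewrite setTI; congr measurable.
by apply/seteqP; split => t /= /eqP.
Qed.

End Measurability.

Section TorusMeasurability.
Context {R : realType}.
Local Notation C := R[i].

Lemma measurable_angles : measurable (@angles R).
Proof. exact: measurable_itv. Qed.

Lemma measurable_proj31 : measurable_fun [set: R * R * R] (fun t => t.1.1).
Proof. exact: measurableT_comp measurable_fst measurable_fst. Qed.

Lemma measurable_proj32 : measurable_fun [set: R * R * R] (fun t => t.1.2).
Proof. exact: measurableT_comp measurable_snd measurable_fst. Qed.

Lemma measurable_ball2 (w : C * C) (e : R) : measurable (@cis2 R @^-1` ball2 w e).
Proof.
rewrite (_ : _ @^-1` _ = [set t : R * R | modulus (cis t.1 - w.1) ^+ 2
    + modulus (cis t.2 - w.2) ^+ 2 < e ^+ 2]).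
  apply: measurable_set_lt; apply: measurable_funD; apply: measurable_dist2.
    exact: measurable_fst.
  exact: measurable_snd.
by apply/seteqP; split => t /=; rewrite /ball2 /= => -[]//; split => //; exact: torus2_cis2.
Qed.

(** Points [cis3 t] are always on the torus, so only the strict distance inequality remains; it
    makes the preimage measurable and open. *)
Lemma ball3_cis3 (w : C * C * C) (e : R) : @cis3 R @^-1` ball3 w e =
  [set t : R * R * R | modulus (cis t.1.1 - w.1.1) ^+ 2
    + modulus (cis t.1.2 - w.1.2) ^+ 2 + modulus (cis t.2 - w.2) ^+ 2 < e ^+ 2].
Proof.
by apply/seteqP; split => t /=; rewrite /ball3 /= => -[]//; split => //; exact: torus3_cis3.
Qed.

Lemma measurable_ball3 (w : C * C * C) (e : R) :
  measurable (@cis3 R @^-1` ball3 w e).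
Proof.
rewrite ball3_cis3; apply: measurable_set_lt.
apply: measurable_funD; first apply: measurable_funD.
- exact: (measurable_dist2 _ measurable_proj31).
- exact: (measurable_dist2 _ measurable_proj32).
- exact: (measurable_dist2 _ measurable_snd).
Qed.

Lemma measurable_modulus_eval2 (s : mpolynomial 2 C) :
  measurable_fun setT (fun t => modulus (eval2 s (cis2 t)) ^+ 2).
Proof.
rewrite [X in measurable_fun _ X](_ : _ = fun t : R * R =>
    modulus (eval2 s (cis2 (t.1, t.2))) ^+ 2).
  exact: measurable_eval2 measurable_fst measurable_snd.
by apply/funext => -[].
Qed.

Lemma measurable_modulus_eval3 (s : mpolynomial 3 C) :
  measurable_fun setT (fun t => modulus (eval3 s (cis3 t)) ^+ 2).
Proof.
rewrite [X in measurable_fun _ X](_ : _ = fun t : R * R * R =>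
    modulus (eval3 s (cis3 (t.1.1, t.1.2, t.2))) ^+ 2).
  exact: measurable_eval3 measurable_proj31 measurable_proj32 measurable_snd.
by apply/funext => -[[]].
Qed.

Lemma measurable_nonzeros (s : mpolynomial 3 C) :
  measurable (@cis3 R @^-1` nonzeros s).
Proof.
rewrite (_ : _ @^-1` _ = [set t : R * R * R | modulus (eval3 s (cis3 t)) ^+ 2 != 0]).
  by apply: measurable_set_neq0; exact: measurable_modulus_eval3.
by apply/seteqP; split => t; rewrite /nonzeros /= sqrf_eq0 modulus_eq0.
Qed.

End TorusMeasurability.

(** * Powers of the kernel integrated over the circle *)

Section CircleIntegral.
Context {R : realType}.
Local Notation C := R[i].

Lemma pow_ereal_ge0 (a e : R) : (0 <= pow_ereal a e)%E.
Proof. by rewrite /pow_ereal; case: ifP => _//; rewrite lee_fin powR_ge0. Qed.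

(** One factor [x] is left untouched for the mean value bound; the remaining power is controlled by
    [x <= 4 * M ^+ 2 / s]. *)
Lemma powR_poisson_le (A B : C) (q M t s x : R) : 1 <= q ->
  modulus B < modulus A -> modulus A <= M ->
  s = modulus A ^+ 2 - modulus B ^+ 2 ->
  x = s / modulus (A + B * cis t) ^+ 2 ->
  x `^ q <= x * ((4 * M ^+ 2) `^ (q - 1) * s `^ (1 - q)).
Proof.
move=> q1 BA AM sE xE; have B0 := modulus_ge0 B.
have Bc : modulus (B * cis t) = modulus B.
  by rewrite modulusM ((circleE (cis t)).1 (circle_cis t)) mulr1.
have D1 : modulus A - modulus B <= modulus (A + B * cis t).
  by rewrite -Bc; exact: ler_modulusB.
have D0 : 0 < modulus (A + B * cis t) by rewrite (lt_le_trans _ D1)// subr_gt0.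
have s0 : 0 < s.
  rewrite sE subr_sqr mulr_gt0// ?subr_gt0// ltr_wpDr//.
  exact: le_lt_trans BA.
have x0 : 0 < x by rewrite xE divr_gt0// exprn_gt0.
have xM : x <= 4 * M ^+ 2 * s^-1.
  rewrite xE ler_pdivrMr ?exprn_gt0// mulrAC ler_pdivlMr//.
  (* Here s = (|A| - |B|)(|A| + |B|); the first factor is at most the denominator by the reverse
     triangle inequality, the second at most 2 M. Squaring gives the bound on [x]. *)
  have le1 : s <= 2 * M * modulus (A + B * cis t).
    rewrite sE subr_sqr mulrC; apply: ler_pM => //.
    - by rewrite addr_ge0 ?modulus_ge0.
    - by rewrite subr_ge0 ltW.
    - by rewrite mulr2n mulrDl !mul1r lerD// (le_trans (ltW BA)).
  rewrite -expr2 (_ : 4 * M ^+ 2 * modulus (A + B * cis t) ^+ 2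
    = (2 * M * modulus (A + B * cis t)) ^+ 2); last by ring.
  by rewrite ler_pXn2r// ?nnegrE ?(ltW s0)// (le_trans (ltW s0)).
have -> : x `^ q = x * x `^ (q - 1).
  rewrite -[X in X * _](powRr1 (ltW x0)) -powRD; first by rewrite addrC subrK.
  by apply/implyP => _; rewrite gt_eqF.
rewrite ler_pM2l//; apply: (@le_trans _ _ ((4 * M ^+ 2 * s^-1) `^ (q - 1))).
  apply: ge0_ler_powR => //; rewrite ?nnegrE ?subr_ge0// ?(ltW x0)//.
  exact: le_trans (ltW x0) xM.
rewrite powRM ?invr_ge0 ?(ltW s0)//; last by rewrite mulr_ge0 ?sqr_ge0.
by rewrite -(powR_inv1 (ltW s0)) -powRrM mulN1r opprB.
Qed.

Lemma measurable_modulus_affine_cis (A B : C) :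
  measurable_fun setT (fun t : R => modulus (A + B * cis t) ^+ 2).
Proof.
have add (f g : R -> R) : measurable_fun setT f -> measurable_fun setT g ->
  measurable_fun setT (fun t => f t + g t) by exact: measurable_funD.
have mul (f g : R -> R) : measurable_fun setT f -> measurable_fun setT g ->
  measurable_fun setT (fun t => f t * g t) by exact: measurable_funM.
have cst c : complex_in (fun f : R -> R => measurable_fun setT f) (fun=> c).
  by apply: complex_in_cst => ?; exact: measurable_cst.
apply: (@complex_in_modulus2 _ _ (fun f : R -> R => measurable_fun setT f)) => //.
apply: complex_inD => //; apply: complex_inM => //.
exact: (measurable_cis (@measurable_id _ R setT)).
Qed.

Lemma integral_poisson_le (A B : C) : modulus B < modulus A ->
  (\int[lebesgue_measure]_(t in `[0%R, (2 * pi)%R])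
    ((modulus A ^+ 2 - modulus B ^+ 2)
      / modulus (A + B * cis t) ^+ 2)%:E <= (2 * (2 * pi))%:E :> \bar R)%E.
Proof.
move=> BA; have A0 : 0 < modulus A by rewrite (le_lt_trans _ BA)// modulus_ge0.
have A0' : A != 0 by rewrite -modulus_eq0 gt_eqF.
have [n hn] : exists n, forall t : R,
    (modulus A ^+ 2 - modulus B ^+ 2) / modulus (A + B * cis t) ^+ 2
    <= 2 + \sum_(k < n) complex.Re (2 * (- (B / A)) ^+ k.+1 * cis (k.+1%:R * t)).
  have r1 : modulus (- (B / A)) < 1.
    by rewrite modulusN modulusM modulusV ltr_pdivrMr// mul1r.
  have [n hn] := poisson_kernel_majorant r1; exists n => t.
  apply: le_trans (hn t); rewrite le_eqVlt; apply/orP; left; apply/eqP.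
  (* The quotient is homogeneous of degree 0 in [(A, B)], so [A] can be divided out, leaving the
     kernel at r = - B / A. *)
  have -> : A + B * cis t = A * (1 - - (B / A) * cis t) by field.
  have ct : modulus (cis t) = 1 by apply/circleE/circle_cis.
  rewrite [in RHS]modulusM ct mulr1 modulusM modulusN modulusM modulusV.
  (* With a zero denominator both quotients are 0 by convention. *)
  have [->|D0] := eqVneq (modulus (1 - - (B / A) * cis t)) 0.
    by rewrite !(mulr0, expr0n, invr0).
  by field; rewrite D0 gt_eqF.
rewrite -(integral_trigonometric_polynomial _ (fun k => 2 * (- (B / A)) ^+ k.+1) n).
have mD := measurable_modulus_affine_cis A B.
have f0 (t : R) : 0 <= (modulus A ^+ 2 - modulus B ^+ 2) / modulus (A + B * cis t) ^+ 2.
  rewrite divr_ge0// ?sqr_ge0// subr_ge0 ler_pXn2r// ?nnegrE ?modulus_ge0//.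
  exact: ltW.
apply: ge0_le_integral => //.
- by move=> t _; rewrite lee_fin.
- apply: measurable_funTS; apply/measurable_EFinP; apply: measurable_funM.
    exact: measurable_cst.
  by apply: measurable_invr => // t; exact: sqr_ge0.
- apply: measurable_funTS; apply/measurable_EFinP; apply: measurable_funD.
    exact: measurable_cst.
  apply: measurable_sum => k.
  rewrite [X in measurable_fun _ X](_ : _ = fun t : R =>
    complex.Re (2 * (- (B / A)) ^+ k.+1) * cos (k.+1%:R * t)
    - complex.Im (2 * (- (B / A)) ^+ k.+1) * sin (k.+1%:R * t)); last first.
    by apply/funext => t; exact: Re_mul_cis.
  have mk : measurable_fun setT (fun t : R => k.+1%:R * t) by exact: mulrl_measurable.
  apply: measurable_funB; apply: measurable_funM; try exact: measurable_cst.
    exact: measurableT_comp (continuous_measurable_fun (@continuous_cos R)) mk.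
  exact: measurableT_comp (continuous_measurable_fun (@continuous_sin R)) mk.
- by move=> t _; rewrite lee_fin.
Qed.

Lemma integral_powR_poisson_le (A B : C) (q M : R) : 1 <= q ->
  modulus B <= modulus A -> modulus A <= M ->
  (\int[lebesgue_measure]_(t in `[0%R, (2 * pi)%R])
    (((modulus A ^+ 2 - modulus B ^+ 2)
      / modulus (A + B * cis t) ^+ 2) `^ q)%:E <=
   (2 * (2 * pi) * (4 * M ^+ 2) `^ (q - 1))%:E
   * pow_ereal (modulus A ^+ 2 - modulus B ^+ 2) (1 - q) :> \bar R)%E.
Proof.
move=> q1 BA AM; set s := _ - _.
have c0 : 0 <= 2 * (2 * pi) * (4 * M ^+ 2) `^ (q - 1).
  by rewrite mulr_ge0 ?powR_ge0// !mulr_ge0// pi_ge0.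
move: BA; rewrite le_eqVlt => /orP[/eqP BA|BA].
  (* When |A| = |B| the integrand is 0^q = 0, and the right-hand side, possibly infinite, is
     nonnegative. *)
  rewrite integral0_eq; first by rewrite mule_ge0 ?lee_fin// pow_ereal_ge0.
  move=> t _; rewrite /s BA subrr mul0r powR0// gt_eqF//.
  exact: lt_le_trans q1.
have s0 : 0 < s by rewrite /s subr_gt0 ltr_pXn2r// nnegrE modulus_ge0.
have -> : pow_ereal s (1 - q) = (s `^ (1 - q))%:E by rewrite /pow_ereal gt_eqF.
set c := (4 * M ^+ 2) `^ (q - 1).
have mD := measurable_modulus_affine_cis A B.
have mx : measurable_fun setT (fun t : R => s / modulus (A + B * cis t) ^+ 2).
  apply: measurable_funM; first exact: measurable_cst.
  by apply: measurable_invr => // t; exact: sqr_ge0.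
have x0 (t : R) : 0 <= s / modulus (A + B * cis t) ^+ 2.
  by rewrite divr_ge0// ?sqr_ge0// ltW.
apply: (@le_trans _ _ (\int[lebesgue_measure]_(t in `[0%R, (2 * pi)%R])
    ((c * s `^ (1 - q))%:E * (s / modulus (A + B * cis t) ^+ 2)%:E))%E).
  apply: ge0_le_integral => //.
  - by move=> t _; rewrite lee_fin powR_ge0.
  - apply: measurable_funTS; apply/measurable_EFinP.
    exact: measurableT_comp (measurable_powR _) mx.
  - apply: measurable_funTS; apply: emeasurable_funM; first exact: measurable_cst.
    exact/measurable_EFinP.
  - move=> t _; rewrite -EFinM lee_fin [leRHS]mulrC.
    exact: powR_poisson_le BA AM _ _.
rewrite ge0_integralZl//; last 3 first.
- by apply: measurable_funTS; exact/measurable_EFinP.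
- by move=> t _; rewrite lee_fin.
- by rewrite lee_fin mulr_ge0// powR_ge0.
rewrite [leRHS](_ : _ = (c * s `^ (1 - q))%:E * (2 * (2 * pi))%:E)%E.
  by rewrite lee_wpmul2l ?lee_fin ?mulr_ge0 ?powR_ge0//; exact: integral_poisson_le.
by rewrite -!EFinM; congr (_%:E); ring.
Qed.

End CircleIntegral.

(** * Tonelli on rectangles *)

Section ProductIntegral.
Context {R : realType} {d1 d2 : measure_display}.
Context {X : measurableType d1} {Y : measurableType d2}.
Variables (mu : {sigma_finite_measure set X -> \bar R}).
Variables (nu : {sigma_finite_measure set Y -> \bar R}).
Variable f : X * Y -> \bar R.
Hypothesis f0 : forall z, (0 <= f z)%E.
Hypothesis mf : measurable_fun setT f.

Lemma measurable_integral_section (B : set Y) : measurable B ->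
  measurable_fun setT (fun x => \int[nu]_(y in B) f (x, y))%E.
Proof.
move=> mB; have mX : measurable ([set: X] `*` B) by exact: measurableX.
have mfB : measurable_fun setT (f \_ ([set: X] `*` B)).
  by apply/(measurable_restrictT _ mX); exact: measurable_funTS.
have := @measurable_fun_fubini_tonelli_F _ _ _ _ _ nu _ mfB.
have fB0 z : (0 <= (f \_ ([set: X] `*` B)) z)%E by exact: erestrict_ge0.
move=> /(_ fB0); congr measurable_fun; apply/funext => x.
rewrite /fubini_F [RHS]integral_mkcond; apply: eq_integral => y _.
by rewrite /patch in_setX in_setT.
Qed.

(** Extension by zero off the rectangle reduces this to Tonelli on the whole product, since it
    commutes with taking sections. *)
Lemma ge0_integral_setX (A : set X) (B : set Y) : measurable A -> measurable B ->
  (\int[mu \x nu]_(z in A `*` B) f z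
   = \int[mu]_(x in A) \int[nu]_(y in B) f (x, y))%E.
Proof.
move=> mA mB; have mX : measurable (A `*` B) by exact: measurableX.
rewrite integral_mkcond fubini_tonelli1; last 2 first.
- by apply/(measurable_restrictT _ mX); exact: measurable_funTS.
- by move=> z; exact: erestrict_ge0.
rewrite [RHS]integral_mkcond; apply: eq_integral => x _.
rewrite /fubini_F [in RHS]/patch; case: ifPn => xA.
  rewrite [RHS]integral_mkcond; apply: eq_integral => y _.
  by rewrite /patch in_setX xA.
by rewrite integral0_eq// => y _; rewrite /patch in_setX (negbTE xA).
Qed.

End ProductIntegral.

Section TripleProductIntegral.
Context {R : realType} {d1 d2 d3 : measure_display}.
Context {X1 : measurableType d1} {X2 : measurableType d2} {Y : measurableType d3}.
Variables (mu1 : {sigma_finite_measure set X1 -> \bar R}).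
Variables (mu2 : {sigma_finite_measure set X2 -> \bar R}).
Variables (nu : {sigma_finite_measure set Y -> \bar R}).

Lemma sigma_finite_product_measure : sigma_finite setT (mu1 \x mu2)%E.
Proof.
have /sigma_finiteP[F [FT Fnd Ffin]] := sigma_finiteT mu1.
have /sigma_finiteP[G [GT Gnd Gfin]] := sigma_finiteT mu2.
exists (fun n => F n `*` G n) => [|n].
  apply/seteqP; split => // -[x y] _.
  have [i _ Fx] : (\bigcup_n F n) x by rewrite -FT.
  have [j _ Gy] : (\bigcup_n G n) y by rewrite -GT.
  (* Both exhausting sequences are nondecreasing, so a common later index covers both
     coordinates. *)
  exists (maxn i j) => //; split => /=.
    exact: (subsetPset _ _ (Fnd _ _ (leq_maxl i j))) Fx.
  exact: (subsetPset _ _ (Gnd _ _ (leq_maxr i j))) Gy.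
have [mF Foo] := Ffin n; have [mG Goo] := Gfin n.
split; first exact: measurableX.
by rewrite product_measure1E// lte_mul_pinfty// ge0_fin_numE.
Qed.

(* The canonical sigma-finite structure on products is only registered for
   subprobabilities, so it has to be packed by hand here. *)
Lemma ge0_integral_setX3 (f : X1 * X2 * Y -> \bar R) (A : set (X1 * X2)) (B : set Y) :
  (forall z, 0 <= f z)%E -> measurable_fun setT f ->
  measurable A -> measurable B ->
  (\int[(mu1 \x mu2) \x nu]_(z in A `*` B) f z
   = \int[mu1 \x mu2]_(x in A) \int[nu]_(y in B) f (x, y))%E.
Proof.
move=> f0 mf mA mB.
pose mu12 : {sigma_finite_measure set (X1 * X2)%type -> \bar R} :=
  HB.pack_for {sigma_finite_measure set (X1 * X2)%type -> \bar R}
    (mu1 \x mu2)%E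
    (Measure_isSigmaFinite.Build _ _ _ (mu1 \x mu2)%E sigma_finite_product_measure).
exact: (ge0_integral_setX mu12 nu f0 mf mA mB).
Qed.

End TripleProductIntegral.

(** * Integrability on finite unions *)

Section IntegrableUnion.
Context {R : realType} {d : measure_display} {T : measurableType d}.
Variable mu : {measure set T -> \bar R}.

Lemma integrable_setU (A B : set T) (f : T -> \bar R) :
  measurable A -> measurable B ->
  mu.-integrable A f -> mu.-integrable B f -> mu.-integrable (A `|` B) f.
Proof.
move=> mA mB iA iB; have /integrableP[mfA fA] := iA; have /integrableP[mfB fB] := iB.
have mBA : measurable (B `\` A) by exact: measurableD.
have mfBA : measurable_fun (B `\` A) f.
  by apply: measurable_funS mfB => //; exact: subDsetl.
have -> : A `|` B = A `|` (B `\` A) by rewrite setUDr setDv setD0.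
have mfU : measurable_fun (A `|` (B `\` A)) f by apply/measurable_funU.
apply/integrableP; split => //.
rewrite integral_setU//; first last.
- by apply/disj_setPS => x [Ax []].
- exact: measurableT_comp.
apply: lte_add_pinfty => //.
by have /integrableP[] := integrableS mB mBA (@subDsetl _ _ _) iB.
Qed.

Lemma integrable_bigsetU (I : eqType) (r : seq I) (A : I -> set T) (f : T -> \bar R) :
  (forall i, measurable (A i)) -> (forall i, mu.-integrable (A i) f) ->
  mu.-integrable (\big[setU/set0]_(i <- r) A i) f.
Proof.
move=> mA iA; elim: r => [|i r IH].
  by rewrite big_nil; exact: integrable_set0.
by rewrite big_cons; apply: integrable_setU => //; exact: bigsetU_measurable.
Qed.

End IntegrableUnion.

(** * Covering the torus by finitely many balls *)

Section Angles.
Context {R : realType}.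
Local Notation C := R[i].

Lemma open_ball3 (w : C * C * C) (e : R) : open (@cis3 R @^-1` ball3 w e).
Proof.
have cD (f g : R * R * R -> R) : continuous f -> continuous g ->
    continuous (fun t => f t + g t).
  by move=> cf cg x; apply: cvgD; [exact: cf|exact: cg].
have cM (f g : R * R * R -> R) : continuous f -> continuous g ->
    continuous (fun t => f t * g t).
  by move=> cf cg x; apply: cvgM; [exact: cf|exact: cg].
have cC (c : R) : continuous (fun _ : R * R * R => c) by move=> x; exact: cvg_cst.
have dist (h : R * R * R -> R) (c : C) : continuous h ->
    continuous (fun t => modulus (cis (h t) - c) ^+ 2).
  move=> ch.
  apply: (@complex_in_modulus2 _ _ (fun g : R * R * R -> R => continuous g)) => //.
  apply: (complex_inD cD); last exact: (complex_in_cst cC).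
  split => t.
    exact: (@continuous_comp _ _ _ h cos t (ch t) (@continuous_cos R _)).
  exact: (@continuous_comp _ _ _ h sin t (ch t) (@continuous_sin R _)).
have c1 : continuous (fun t : R * R * R => t.1.1).
  by move=> t; apply: (@continuous_comp _ _ _ fst fst); exact: cvg_fst.
have c2 : continuous (fun t : R * R * R => t.1.2).
  by move=> t; apply: (@continuous_comp _ _ _ fst snd); [exact: cvg_fst|exact: cvg_snd].
have c3 : continuous (fun t : R * R * R => t.2) by move=> t; exact: cvg_snd.
rewrite ball3_cis3 (_ : [set _ | _] = (fun t : R * R * R =>
  modulus (cis t.1.1 - w.1.1) ^+ 2 + modulus (cis t.1.2 - w.1.2) ^+ 2
  + modulus (cis t.2 - w.2) ^+ 2) @^-1` [set x | x < e ^+ 2])//.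
apply: open_comp; last exact: open_lt.
by move=> t _; apply: (cD _ _ (cD _ _ _ _)); apply: dist.
Qed.

Lemma ball3_center (w : C * C * C) (e : R) : torus3 w -> 0 < e -> ball3 w e w.
Proof.
move=> tw e0; split => //; have m0 : modulus (0 : C) = 0 by apply/eqP; rewrite modulus_eq0.
by rewrite !subrr m0 expr0n /= !addr0 exprn_gt0.
Qed.

(* Compactness applies to the closed cube; the angles form a half-open one. A
   finite subcover is extracted from the filter of the lists of points that
   contain some given list. *)
Lemma torus3_finite_cover (e : R * R * R -> R) : (forall t, 0 < e t) ->
  exists r : seq (R * R * R), @angles R `*` @angles R `*` @angles R `<=`
    \big[setU/set0]_(t <- r) (@cis3 R @^-1` ball3 (cis3 t) (e t)).
Proof.
move=> e0; pose J : set R := `[0, 2 * pi]%classic.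
have cJ : compact (J `*` J `*` J).
  by apply: compact_setX; [apply: compact_setX|]; exact: segment_compact.
pose F : set_system (seq (R * R * R)) :=
  [set S : set (seq (R * R * R)) | exists r0 : seq (R * R * R),
    forall r : seq (R * R * R), {subset r0 <= r} -> S r].
have FF : Filter F.
  split => [|P Q [p Pp] [q Qq]|P Q PQ [p Pp]]; first by exists [::].
    exists (p ++ q) => r pqr; split; [apply: Pp|apply: Qq] => x xr;
      by apply: pqr; rewrite mem_cat xr ?orbT.
  by exists p => r /Pp/PQ.
have [|r Jr] := (compact_near_coveringP _).1 cJ _ F
    (fun (r : seq (R * R * R)) u => exists2 t, t \in r &
      (@cis3 R @^-1` ball3 (cis3 t) (e t)) u) FF.
  move=> x Jx.
  exists (@cis3 R @^-1` ball3 (cis3 x) (e x), [set r : seq (R * R * R) | x \in r]).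
    split; last by exists [:: x] => r; apply; rewrite mem_head.
    apply: open_nbhs_nbhs; split; first exact: open_ball3.
    by apply: ball3_center => //; exact: torus3_cis3.
  by move=> [u r] [/= ux xr]; exists x.
exists r => t [[a1 a2] a3].
have aJ : @angles R `<=` J by apply: subset_itvl; rewrite bnd_simp.
(* The covering property holds for every list containing [r], in particular for [r] itself. *)
have [|u ur tu] := Jr r (fun _ => id) t; first by split; [split|]; exact: aJ.
by rewrite -bigcup_seq; exists u.
Qed.

End Angles.

(** * Local and global integrability of the derivative; integrability of rho *)

Section DerivativeIntegrability.
Context {R : realType}.
Local Notation C := R[i].
Variables (m1 m2 : nat) (p1 p2 : mpolynomial 2 C) (q : R).
Let p : mpolynomial 3 C :=
  mpoly.mwiden p1 + mpoly.mwiden p2 * mpoly.mpolyX C (mpoly.mnm1 ord_max).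
Hypothesis dp : has_polydegree p (mdeg3 m1 m2 1).
Hypothesis sp : stable p.
Hypothesis q1 : 1 <= q.

Let s (t : R * R) : R :=
  modulus (eval2 p1 (cis2 t)) ^+ 2 - modulus (eval2 p2 (cis2 t)) ^+ 2.
(** A measurable function on all of the angle space that equals the q-th power of the modulus of the
    derivative off the zeros of [p], and 0 on them. The derivative inherits its measurability from
    [g]. *)
Let g (t : R * R * R) : R := (s t.1 / modulus (eval3 p (cis3 t)) ^+ 2) `^ q.
Let dom (A : set (C * C * C)) : set (R * R * R) :=
  (@angles R `*` @angles R `*` @angles R) `&` @cis3 R @^-1` (A `&` nonzeros p).

Let s_ge0 t : 0 <= s t.
Proof.
rewrite subr_ge0 ler_pXn2r// ?nnegrE ?modulus_ge0//.
by apply: stable_torus => //; exact: torus2_cis2.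
Qed.

Let measurable_s : measurable_fun setT s.
Proof. by apply: measurable_funB; exact: measurable_modulus_eval2. Qed.

Let measurable_g : measurable_fun setT g.
Proof.
apply: (measurableT_comp (measurable_powR q)); apply: measurable_funM.
  exact: measurableT_comp measurable_s measurable_fst.
apply: measurable_invr; last exact: measurable_modulus_eval3.
by move=> t; exact: sqr_ge0.
Qed.

Let measurable_dom A : measurable (@cis3 R @^-1` A) -> measurable (dom A).
Proof.
move=> mA; apply: measurableI; last exact: measurableI mA (measurable_nonzeros p).
by apply: measurableX; [apply: measurableX|]; exact: measurable_angles.
Qed.

Let dz3E A t : dom A t ->
  modulus (rif_dz3 (mdeg3 m1 m2 1) p (cis3 t)) `^ q = g t.
Proof.
move=> [_ [_ pt]]; rewrite /g modulus_rif_dz3//.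
- by rewrite ger0_norm//; exact: s_ge0.
- exact: torus2_cis2.
- exact: circle_cis.
Qed.

Lemma Lp_on_torus3E A : measurable (@cis3 R @^-1` A) ->
  Lp_on_torus3 q (A `&` nonzeros p) (rif_dz3 (mdeg3 m1 m2 1) p) <->
  ((@lebesgue_measure R \x @lebesgue_measure R) \x @lebesgue_measure R)%E.-integrable
    (dom A) (fun t => (g t)%:E).
Proof.
move=> mA; have mD := measurable_dom mA.
rewrite /Lp_on_torus3 /leb3 /leb2.
by split; apply: eq_integrable => // t /set_mem Dt; rewrite (dz3E Dt).
Qed.

Lemma dz3_in_LpE : dz3_in_Lp (mdeg3 m1 m2 1) p q <->
  forall w, torus3 w -> dz3_in_Lp_loc (mdeg3 m1 m2 1) p q w.
Proof.
have mT : measurable (@cis3 R @^-1` (@torus3 R)).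
  rewrite (_ : _ @^-1` _ = setT)//; apply/seteqP; split => // t _.
  exact: torus3_cis3.
split => [/(Lp_on_torus3E mT) iT w tw|iw].
  exists 1 => //; apply/Lp_on_torus3E; first exact: measurable_ball3.
  apply: integrableS iT; [exact: measurable_dom| |].
    by apply: measurable_dom; exact: measurable_ball3.
  by move=> t [at_ [[tt _] pt]].
apply/(Lp_on_torus3E mT).
pose P t e := 0 < e /\
  Lp_on_torus3 q (ball3 (cis3 t) e `&` nonzeros p) (rif_dz3 (mdeg3 m1 m2 1) p).
(* The radii of local integrability vary with the point; choice turns them into a function to which
   the finite cover applies. *)
have [e he] : {e & forall t, P t (e t)}.
  by apply: choice => t; have [e e0 ie] := iw _ (torus3_cis3 t); exists e.
have [|r cover] := @torus3_finite_cover R e; first by move=> t; have [] := he t.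
pose A t := dom (ball3 (cis3 t) (e t)).
have mA t : measurable (A t) by apply: measurable_dom; exact: measurable_ball3.
have iA : ((@lebesgue_measure R \x @lebesgue_measure R) \x @lebesgue_measure R)%E.-integrable
    (\big[setU/set0]_(t <- r) A t) (fun t => (g t)%:E).
  apply: integrable_bigsetU => // t; apply/Lp_on_torus3E; first exact: measurable_ball3.
  exact: (he t).2.
apply: integrableS iA.
- by apply: bigsetU_measurable => t _; exact: mA.
- exact: measurable_dom.
- move=> t [at_ [tt pt]]; have := cover _ at_.
  by rewrite -!bigcup_seq => -[u ur tu]; exists u.
Qed.

Variables (xi : C * C) (eps : R).
Hypothesis eps0 : 0 < eps.
Hypothesis hint : (integral_torus2 (ball2 xi eps)
  (fun z => pow_ereal (sigma m1 m2 p1 p2 z) (1 - q)) < +oo)%E.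

Let E : set (R * R) :=
  (@angles R `*` @angles R) `&` @cis2 R @^-1` (ball2 xi eps).

Let measurable_E : measurable E.
Proof.
apply: measurableI; last exact: measurable_ball2.
by apply: measurableX; exact: measurable_angles.
Qed.

Let integral_s : (\int[@lebesgue_measure R \x @lebesgue_measure R]_(t in E)
  pow_ereal (s t) (1 - q) < +oo)%E.
Proof.
apply: le_lt_trans hint; rewrite /integral_torus2 le_eqVlt; apply/orP; left.
apply/eqP; apply: eq_integral => t _; rewrite (sigmaE dp)//.
exact: torus2_cis2.
Qed.

(** A ball about [(xi, xi3)] lies in the cylinder of all points above the two-dimensional ball of
    the same radius, so integrating out the whole circle handles every [xi3] with the one radius
    [eps]. *)
Lemma vertical_line_in_Lp_loc (xi3 : C) :
  dz3_in_Lp_loc (mdeg3 m1 m2 1) p q (xi, xi3).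
Proof.
have mB := measurable_ball3 (xi, xi3) eps.
exists eps => //; apply/Lp_on_torus3E => //; apply/integrableP; split.
  exact/measurable_funTS/measurable_EFinP.
pose I : set R := `[0, 2 * pi]%classic.
have g0 t : (0 <= (g t)%:E)%E by rewrite lee_fin powR_ge0.
have mg : measurable_fun setT (fun t => (g t)%:E) by exact/measurable_EFinP.
have mI : measurable I by exact: measurable_itv.
have [M M0 hM] := eval2_bounded p1.
apply: (@le_lt_trans _ _
  (\int[(@lebesgue_measure R \x @lebesgue_measure R) \x @lebesgue_measure R]_(t in E `*` I)
    (g t)%:E)%E).
  under eq_integral do rewrite gee0_abs//.
  apply: ge0_subset_integral => //; first exact: measurable_dom.
  - exact: measurableX.
  - exact: measurable_funTS.
  - move=> t [[[a1 a2] a3] [[_ dt] _]]; split; last first.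
      by move: a3; apply: subset_itvl; rewrite bnd_simp.
    split => //; split; first exact: torus2_cis2.
    by apply: le_lt_trans dt; rewrite lerDl sqr_ge0.
rewrite (ge0_integral_setX3 (@lebesgue_measure R) (@lebesgue_measure R)
  (@lebesgue_measure R) g0 mg measurable_E mI).
set c := 2 * (2 * pi) * (4 * M ^+ 2) `^ (q - 1).
have c0 : 0 <= c by rewrite mulr_ge0 ?powR_ge0// !mulr_ge0// pi_ge0.
(* The constant comes from the circle estimate, with [M] bounding |p1| on the torus; it is the same
   for all fibres. *)
apply: (@le_lt_trans _ _ (\int[@lebesgue_measure R \x @lebesgue_measure R]_(t in E)
    (c%:E * pow_ereal (s t) (1 - q)))%E).
  apply: ge0_le_integral => //.
  - by move=> t _; apply: integral_ge0.
  - apply: measurable_funTS.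
    exact: (measurable_integral_section (@lebesgue_measure R) g0 mg mI).
  - apply: measurable_funTS; apply: emeasurable_funM; first exact: measurable_cst.
    exact: measurable_pow_ereal.
  - move=> t _; have tt := torus2_cis2 t.
    have h := integral_powR_poisson_le q1 (stable_torus sp tt) (hM _ tt).
    apply: le_trans h; rewrite le_eqVlt; apply/orP; left; apply/eqP.
    by apply: eq_integral => y _; rewrite /g eval3_affine.
rewrite ge0_integralZl//.
- by apply: lte_mul_pinfty => //; rewrite ?lee_fin.
- by apply: measurable_funTS; exact: measurable_pow_ereal.
- by move=> t _; exact: pow_ereal_ge0.
Qed.

(** The exponent is nonpositive, so dividing by [v] multiplies the power by v^(q-1), which is
    monotone in [v]. *)
Lemma pow_ereal_div_le (u v V : R) : 0 <= u -> 0 < v -> v <= V ->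
  (pow_ereal (u / v) (1 - q) <= (V `^ (q - 1))%:E * pow_ereal u (1 - q))%E.
Proof.
move=> u0 v0 vV; have V0 : 0 < V by exact: lt_le_trans vV.
have q0 : 0 <= q - 1 by rewrite subr_ge0.
have vi0 : 0 < v^-1 by rewrite invr_gt0.
rewrite /pow_ereal mulf_eq0 invr_eq0 (gt_eqF v0) orbF.
(* For u = 0 and q > 1 both sides are +oo, the factor V^(q-1) being positive. *)
case: ifPn => _; first by rewrite gt0_muley// lte_fin powR_gt0.
rewrite -EFinM lee_fin powRM ?(ltW vi0)// mulrC ler_wpM2r ?powR_ge0//.
rewrite -(powR_inv1 (ltW v0)) -powRrM mulN1r opprB.
by apply: ge0_ler_powR => //; rewrite nnegrE ltW.
Qed.

Lemma integral_rho_lty :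
  (integral_torus2 (ball2 xi eps `&` rho_domain m1 m2 p1)
    (fun z => pow_ereal (rho m1 m2 p1 p2 z) (1 - q)) < +oo)%E.
Proof.
have [M M0 hM] := eval2_bounded p1.
set r := reflection (mdeg2 m1 m2) p1.
have mr : measurable [set t : R * R | modulus (eval2 r (cis2 t)) ^+ 2 != 0].
  by apply: measurable_set_neq0; exact: measurable_modulus_eval2.
pose F : set (R * R) := E `&` [set t | modulus (eval2 r (cis2 t)) ^+ 2 != 0].
have mF : measurable F by exact: measurableI.
have FE : F `<=` E by exact: subIsetl.
rewrite /integral_torus2 (_ : _ `&` _ = F); last first.
  apply/seteqP; split => t.
    by move=> [at_ [bt [_ rt]]]; split => //=; rewrite sqrf_eq0 modulus_eq0.
  move=> [[at_ bt]] /=; rewrite sqrf_eq0 modulus_eq0 => rt.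
  split; first exact: at_.
  split; first exact: bt.
  split; [exact: torus2_cis2|exact: rt].
apply: (@le_lt_trans _ _ (\int[@lebesgue_measure R \x @lebesgue_measure R]_(t in F)
    (((M ^+ 2) `^ (q - 1))%:E * pow_ereal (s t) (1 - q)))%E).
  apply: ge0_le_integral => //.
  - by move=> t _; exact: pow_ereal_ge0.
  - apply: measurable_funTS; apply: measurable_pow_ereal.
    apply: measurable_funM; first by apply: measurable_funB; exact: measurable_modulus_eval2.
    by apply: measurable_invr => [t|]; [exact: sqr_ge0|exact: measurable_modulus_eval2].
  - apply: measurable_funTS; apply: emeasurable_funM; first exact: measurable_cst.
    exact: measurable_pow_ereal.
  - move=> t [_ /= rt]; rewrite /rho (sigmaE dp); last exact: torus2_cis2.
    (* Here [v] is the squared modulus of the reflected [p1], nonzero on the domain of rho and at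
       most V = M^2 on the torus. *)
    apply: pow_ereal_div_le; first exact: s_ge0.
      by rewrite lt_def rt sqr_ge0.
    rewrite ler_pXn2r// ?nnegrE ?modulus_ge0// ?(ltW M0)// modulus_eval2_reflection.
    + by apply: hM; exact: torus2_cis2.
    + exact: deg_in_low dp.
    + exact: torus2_cis2.
rewrite ge0_integralZl//.
- apply: lte_mul_pinfty; [by rewrite lee_fin powR_ge0|by []|].
  apply: le_lt_trans integral_s.
  apply: ge0_subset_integral.
  - exact: mF.
  - exact: measurable_E.
  - by apply: measurable_funTS; exact: measurable_pow_ereal.
  - by move=> t _; exact: pow_ereal_ge0.
  - exact: FE.
- by apply: measurable_funTS; exact: measurable_pow_ereal.
- by move=> t _; exact: pow_ereal_ge0.
- by rewrite lee_fin powR_ge0.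
Qed.

End DerivativeIntegrability.

(** * The combined statement *)

Unset Implicit Arguments.
Set Strict Implicit.
Set Printing Implicit Defensive.

(** That the line cannot make global integrability worse is expressed by the last two clauses: the
    derivative is locally integrable at each point of the line, and global integrability is decided
    by the points off it. *)
Theorem theorem3p12 (R : realType) (m1 m2 : nat)
    (p : mpolynomial 3 R[i]) (p1 p2 : mpolynomial 2 R[i])
    (xi : R[i] * R[i]) (N : nat) (gamma : 'I_N -> set (R[i] * R[i]))
    (q eps : R)
    (hphi : rif_denominator (mdeg3 m1 m2 1) p)
    (hp : p = mpoly.mwiden p1
              + mpoly.mwiden p2 * mpoly.mpolyX R[i] (mpoly.mnm1 ord_max))
    (hline : vertical_line_singularity p xi)
    (hdim : pure_dimension_one (sigma_zeros m1 m2 p1 p2))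
    (hcurves : rho_zeros m1 m2 p1 p2 = \bigcup_(i in [set: 'I_N]) gamma i)
    (hsmooth : forall i, smooth_curve (gamma i))
    (hq : 1 <= q)
    (heps : 0 < eps)
    (hint : (integral_torus2 (ball2 xi eps)
               (fun z => pow_ereal (sigma m1 m2 p1 p2 z) (1 - q)) < +oo)%E) :
  (exists delta : R, [/\ 0 < delta, delta <= eps &
     (integral_torus2 (ball2 xi delta `&` rho_domain m1 m2 p1)
        (fun z => pow_ereal (rho m1 m2 p1 p2 z) (1 - q)) < +oo)%E])
  /\ (forall xi3 : R[i], circle xi3 ->
        dz3_in_Lp_loc (mdeg3 m1 m2 1) p q (xi, xi3))
  /\ (dz3_in_Lp (mdeg3 m1 m2 1) p q <->
      forall w : R[i] * R[i] * R[i], torus3 w -> w.1 <> xi ->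
        dz3_in_Lp_loc (mdeg3 m1 m2 1) p q w).
Proof.
case: hphi => sp dp _; subst p.
have rho_lty := integral_rho_lty dp sp hq hint.
have line := vertical_line_in_Lp_loc dp sp hq heps hint.
have global := dz3_in_LpE q dp sp.
(* The bound on |p1| holds on the whole torus, so the ball need not shrink. *)
split; first by exists eps; split; [exact: heps|exact: lexx|exact rho_lty].
split; first by move=> xi3 _; exact (line xi3).
split => [/global loc w tw _|off]; first exact (loc w tw).
apply/global => w tw; have [wxi|wxi] := eqVneq w.1 xi.
  by case: w wxi {tw} => w1 w3 /= ->; exact (line w3).
by apply: off => //; exact/eqP.
Qed.
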